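(* For all integers $k\ge 1$ and $\ell\ge 1$, there are only finitely many $k$-vertex-critical $(2P_2,(3,\ell)\text{-}squid)$-free graphs.
   Context: Graphs are finite and simple, and ''finitely many'' means up to isomorphism. A graph $G$ is $k$-vertex-critical if $\chi(G)=k$ and $\chi(G-v)<k$ for all $v\in V(G)$, where $\chi$ denotes the chromatic number. A graph is $(H_1,H_2)$-free if it contains no induced subgraph isomorphic to $H_1$ or $H_2$. $2P_2$ is the disjoint union of two edges. For $\ell\ge 1$, the $(3,\ell)$-$squid$ is the graph obtained from a triangle $C_3$ by attaching $\ell$ leaves (pendant vertices) to a single vertex of the triangle. *)

(* Defs.v *)
From mathcomp Require Import all_boot.

Set Implicit Arguments.
Unset Strict Implicit.
Unset Printing Implicit Defensive.

Record sgraph := SGraph {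
  vertex :> finType;
  adj : rel vertex;
  adj_sym : symmetric adj;
  adj_irrefl : irreflexive adj
}.

Definition isomorphic (G H : sgraph) : Prop :=
  exists2 f : G -> H, bijective f & {mono f : x y / adj x y}.

Section InducedSubgraph.
Variables (G : sgraph) (S : {set G}).

Definition induced_adj : rel {x : G | x \in S} :=
  fun x y => adj (val x) (val y).

Lemma induced_adj_sym : symmetric induced_adj.
Proof. by move=> x y; apply: adj_sym. Qed.

Lemma induced_adj_irrefl : irreflexive induced_adj.
Proof. by move=> x; apply: adj_irrefl. Qed.

Definition induced : sgraph := SGraph induced_adj_sym induced_adj_irrefl.

End InducedSubgraph.

Definition del_vertex (G : sgraph) (v : G) : sgraph := induced [set~ v].

Definition free (H G : sgraph) : Prop :=
  ~ exists S : {set G}, isomorphic (induced S) H.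

Definition proper_coloring (G : sgraph) (n : nat) (c : {ffun G -> 'I_n}) : bool :=
  [forall x, forall y, adj x y ==> (c x != c y)].

Definition colorable (G : sgraph) (n : nat) : bool :=
  [exists c : {ffun G -> 'I_n}, proper_coloring c].

Lemma ex_colorable (G : sgraph) : exists n, colorable G n.
Proof.
exists #|G|; apply/existsP; exists [ffun x => enum_rank x].
apply/forallP => x; apply/forallP => y; apply/implyP => xy; rewrite !ffunE.
by apply: contraTneq xy => /enum_rank_inj ->; rewrite adj_irrefl.
Qed.

Definition chi (G : sgraph) : nat := ex_minn (ex_colorable G).

Definition vertex_critical (k : nat) (G : sgraph) : Prop :=
  chi G = k /\ forall v : G, chi (del_vertex v) < k.

Section Complete.
Variable n : nat.

Definition complete_adj : rel 'I_n := fun i j => i != j.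

Lemma complete_adj_sym : symmetric complete_adj.
Proof. by move=> i j; rewrite /complete_adj eq_sym. Qed.

Lemma complete_adj_irrefl : irreflexive complete_adj.
Proof. by move=> i; rewrite /complete_adj eqxx. Qed.

Definition complete : sgraph := SGraph complete_adj_sym complete_adj_irrefl.

End Complete.

Section DisjointUnion.
Variables G H : sgraph.

Definition union_adj : rel (G + H)%type := fun u v =>
  match u, v with
  | inl x, inl y => adj x y
  | inr x, inr y => adj x y
  | _, _ => false
  end.

Lemma union_adj_sym : symmetric union_adj.
Proof. by move=> [x|x] [y|y] //=; apply: adj_sym. Qed.

Lemma union_adj_irrefl : irreflexive union_adj.
Proof. by move=> [x|x] /=; apply: adj_irrefl. Qed.

Definition disjoint_union : sgraph := SGraph union_adj_sym union_adj_irrefl.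

End DisjointUnion.

Definition twoP2 : sgraph := disjoint_union (complete 2) (complete 2).

Section Squid.
Variable l : nat.

(* 'I_3 is the triangle, 'I_l the set of leaves, all attached to ord0. *)
Definition squid3_adj : rel ('I_3 + 'I_l)%type := fun u v =>
  match u, v with
  | inl i, inl j => i != j
  | inl i, inr _ | inr _, inl i => i == ord0
  | inr _, inr _ => false
  end.

Lemma squid3_adj_sym : symmetric squid3_adj.
Proof. by move=> [i|i] [j|j] //=; rewrite eq_sym. Qed.

Lemma squid3_adj_irrefl : irreflexive squid3_adj.
Proof. by move=> [i|i] //=; rewrite eqxx. Qed.

Definition squid3 : sgraph := SGraph squid3_adj_sym squid3_adj_irrefl.

End Squid.

Definition finitely_many (P : sgraph -> Prop) : Prop :=
  exists (N : nat) (F : 'I_N -> sgraph),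
    forall G : sgraph, P G -> exists i : 'I_N, isomorphic G (F i).

(* Main.v *)
(* A proper k-colouring of G has k independent classes.  By 2P2-freeness, the
   traces N(a) :&: C of the vertices a of one class on another class C are
   linearly ordered by inclusion, and by criticality N(a) is never contained in
   N(b) for a != b.  So any two vertices of a class are ordered oppositely by
   two classes C and D: one trace grows strictly while the other one shrinks.
   A chain a_0, ..., a_(l+1) for such a pair (C, D) contains a squid: pick c in C
   adjacent to a_l but not to a_(l-1), and d in D adjacent to a_l but not to
   a_(l+1); 2P2-freeness makes c and d adjacent, and d, c, a_l is a triangle with
   leaves a_0, ..., a_(l-1) at d.  Hence chains are short, and recording for each
   (C, D) the lengths of the chains starting at a vertex separates the vertices
   of a class, which bounds |G|. *)
Require Import Defs.
From mathcomp Require Import all_boot.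

Set Implicit Arguments.
Unset Strict Implicit.
Unset Printing Implicit Defensive.

(** * Induced copies of 2P2 and of the squid *)

Lemma isomorphic_sym (G H : sgraph) : isomorphic G H -> isomorphic H G.
Proof.
case=> f [g fK gK] f_mono; exists g; first by exists f.
by move=> x y; rewrite -f_mono !gK.
Qed.

Lemma embedding_not_free (G H : sgraph) (f : H -> G) :
  injective f -> {mono f : x y / adj x y} -> ~ free H G.
Proof.
move=> f_inj f_mono; apply; exists (f @: setT); apply: isomorphic_sym.
have fS x : f x \in f @: setT by rewrite imset_f.
exists (fun x => Sub (f x) (fS x) : induced (f @: setT)) => //.
apply: inj_card_bij => [x y /(congr1 val) /f_inj //|].
by rewrite card_sig card_imset // cardsT.
Qed.

Lemma adj_neq (G : sgraph) (x y : G) : adj x y -> x != y.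
Proof. by apply: contraTneq => ->; rewrite adj_irrefl. Qed.

Lemma twoP2_free_adj (G : sgraph) (a x b y : G) :
    free twoP2 G -> adj a x -> adj b y ->
  ~~ adj a y -> ~~ adj b x -> ~~ adj a b -> adj x y.
Proof.
move=> freeG ax by_ /negPf aNy /negPf bNx /negPf aNb.
apply/negPn/negP => /negPf xNy.
pose f (u : twoP2) : G := match u with
  | inl i => if i == ord0 then a else x
  | inr i => if i == ord0 then b else y
  end.
have f_mono : {mono f : u v / adj u v}.
  move=> [] [[|[|//]] ?] [] [[|[|//]] ?] //=;
    by rewrite ?adj_irrefl // ?ax ?by_ ?aNy ?bNx ?aNb ?xNy //
       adj_sym ?ax ?by_ ?aNy ?bNx ?aNb ?xNy.
apply: (embedding_not_free _ f_mono freeG) => u v fuv.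
(* Vertices with the same image have the same neighbours, and no two distinct vertices of 2P2 do. *)
have: forall w, adj u w = adj v w by move=> w; rewrite -!f_mono fuv.
case: u v {fuv} => [] [[|[|//]] i] [] [[|[|//]] j] adjE;
  try (by congr inl; apply: val_inj); try (by congr inr; apply: val_inj).
all: by move: (adjE (inl ord0)) (adjE (inl ord_max)) (adjE (inr ord0))
            (adjE (inr ord_max)); rewrite /= /complete_adj -!val_eqE.
Qed.

Lemma squid3_embedding (G : sgraph) (l : nat) (d c a : G) (s : 'I_l -> G) :
    injective s -> adj d c -> adj d a -> adj c a -> (forall i, adj d (s i)) ->
    (forall i, ~~ adj c (s i)) -> (forall i, ~~ adj a (s i)) ->
    (forall i j, ~~ adj (s i) (s j)) ->
  ~ free (squid3 l) G.
Proof.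
move=> s_inj dc da ca ds cNs aNs sNs.
have cs i : adj c (s i) = false by exact: negbTE (cNs _).
have as_ i : adj a (s i) = false by exact: negbTE (aNs _).
have ss i j : adj (s i) (s j) = false by exact: negbTE (sNs _ _).
pose f (u : squid3 l) : G := match u with
  | inl i => nth a [:: d; c] i
  | inr i => s i
  end.
have f_mono : {mono f : u v / adj u v}.
  move=> [[[|[|[|//]]] ?]|i] [[[|[|[|//]]] ?]|j] //=;
    by rewrite ?adj_irrefl // ?dc ?da ?ca ?ds ?cs ?as_ ?ss //
       adj_sym ?dc ?da ?ca ?ds ?cs ?as_.
have adjE u v : f u = f v -> forall w, adj u w = adj v w.
  by move=> fuv w; rewrite -!f_mono fuv.
(* A leaf is adjacent to neither of the triangle vertices 1 and 2, a triangle vertex to at least one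
   of them. *)
have fNinlr i j : f (inl i) <> f (inr j).
  move=> /adjE fij; have := (fij (inl (inord 1)), fij (inl (inord 2))).
  by rewrite /= -!val_eqE /= !inordK //; case: i {fij} => -[|[|[|//]]] ? [].
apply: (embedding_not_free _ f_mono) => -[i|i] [j|j] fuv.
- congr inl; apply/eqP; apply: contraFT (adj_irrefl (f (inl i))) => ij.
  by rewrite {2}fuv f_mono.
- by case: (fNinlr _ _ fuv).
- by case: (fNinlr _ _ (esym fuv)).
- by congr inr; apply: s_inj.
Qed.

(** * Colourings and neighbourhoods in critical graphs *)

Lemma chi_leq (G : sgraph) n : colorable G n -> chi G <= n.
Proof. by move=> Gn; rewrite /chi; case: ex_minnP => m _; apply. Qed.

Lemma chi_colorable (G : sgraph) : colorable G (chi G).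
Proof. by rewrite /chi; case: ex_minnP. Qed.

Lemma proper_coloringP (G : sgraph) n (c : {ffun G -> 'I_n}) :
  reflect (forall x y, adj x y -> c x != c y) (proper_coloring c).
Proof.
apply: (iffP forallP) => [c_ok x y | c_ok x].
  by move/forallP: (c_ok x) => /(_ y)/implyP.
by apply/forallP => y; apply/implyP; apply: c_ok.
Qed.

(** Otherwise a colouring of [G] minus [a] extends to [G] by giving [a] the colour of [b]; this is
    the role of the default [bs] in [insubd]. *)
Lemma vertex_critical_nsub (G : sgraph) k (a b : G) :
    vertex_critical k G -> a != b ->
  ~~ ([set x | adj a x] \subset [set x | adj b x]).
Proof.
move=> [chiG crit] ab; apply/negP => /subsetP sub_ab.
have {}sub_ab x : adj a x -> adj b x by move=> ax; move/(_ x): sub_ab; rewrite !inE; apply.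
have /existsP[c /proper_coloringP c_ok] := chi_colorable (del_vertex a).
have b_in : b \in [set~ a] by rewrite !inE eq_sym.
pose bs : del_vertex a := Sub b b_in.
suff: colorable G (chi (del_vertex a)).
  by move/chi_leq; rewrite leqNgt chiG crit.
apply/existsP; exists [ffun x => c (insubd bs x)].
apply/proper_coloringP => x y xy; rewrite !ffunE; apply: c_ok.
rewrite /= /induced_adj !val_insubd !inE.
have [xa|xa] := eqVneq x a; have [ya|ya] //= := eqVneq y a; subst.
- by rewrite adj_irrefl in xy.
- exact: sub_ab.
- by rewrite adj_sym; apply: sub_ab; rewrite adj_sym.
Qed.

(** * Traces on colour classes and opposed chains *)

Section Traces.

Variables (G : sgraph) (k : nat) (c : {ffun G -> 'I_k}).
Hypothesis c_ok : forall x y, adj x y -> c x != c y.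
Hypothesis G2P2 : free twoP2 G.

Definition trace (i : 'I_k) (a : G) : {set G} := [set x | adj a x & c x == i].

Definition opposed (p : 'I_k * 'I_k) : rel G := fun a b =>
  [&& c a == c b, trace p.1 a \proper trace p.1 b
    & trace p.2 b \proper trace p.2 a].

Lemma opposed_trans p : transitive (opposed p).
Proof.
move=> b a d /and3P[/eqP ab ab1 ab2] /and3P[/eqP bd bd1 bd2].
by rewrite /opposed ab bd eqxx (proper_trans ab1) // (proper_trans bd2).
Qed.

Lemma opposed_irrefl p : irreflexive (opposed p).
Proof. by move=> a; rewrite /opposed properxx andbF. Qed.

Lemma same_color_nadj x y : c x = c y -> ~~ adj x y.
Proof. by move=> cxy; apply: contra_eqN cxy => /c_ok. Qed.

(** If [x] and [y] in class [i] were private neighbours of [a] and [b], the edges [ax] and [by]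
    would induce a 2P2. *)
Lemma trace_nsub_proper i a b : c a = c b ->
  ~~ (trace i a \subset trace i b) -> trace i b \proper trace i a.
Proof.
move=> cab /[dup] /subsetPn[x]; rewrite !inE => /andP[ax /eqP cx].
rewrite cx eqxx andbT => bNx ab; rewrite properE ab andbT.
apply/subsetP => y; rewrite !inE => /andP[by_ /[dup] /eqP cy ->]; rewrite andbT.
apply: contraT => aNy.
have := twoP2_free_adj G2P2 ax by_ aNy bNx (same_color_nadj cab).
by rewrite (negPf (same_color_nadj _)) // cx cy.
Qed.

Lemma nsub_trace a b : ~~ ([set x | adj a x] \subset [set x | adj b x]) ->
  exists i, ~~ (trace i a \subset trace i b).
Proof.
case/subsetPn=> x; rewrite !inE => ax bNx; exists (c x).
by apply/subsetPn; exists x; rewrite !inE ?ax ?eqxx // (negPf bNx).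
Qed.

Lemma critical_opposed a b :
    vertex_critical k G -> c a = c b -> a != b ->
  exists p, opposed p a b.
Proof.
move=> crit cab ab; have ba : b != a by rewrite eq_sym.
have [i /(trace_nsub_proper cab) ip] :=
  nsub_trace (vertex_critical_nsub crit ab).
have [j /(trace_nsub_proper (esym cab)) jp] :=
  nsub_trace (vertex_critical_nsub crit ba).
by exists (j, i); rewrite /opposed cab eqxx ip jp.
Qed.

Lemma opposed_chain_squid l p a t :
    0 < l -> size t = l.+1 -> path (opposed p) a t ->
  ~ free (squid3 l) G.
Proof.
move=> l_gt0 sz_t at_path; pose s i := nth a (a :: t) i.
have lt_s i j : i < j -> j <= l.+1 -> opposed p (s i) (s j).
  move=> ij jl; apply: (@sorted_ltn_nth _ _ (@opposed_trans p) a (a :: t)) => //;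
    by rewrite inE /= sz_t ltnS // (leq_trans (ltnW ij)).
have col_s i j : i <= l.+1 -> j <= l.+1 -> c (s i) = c (s j).
  have col0 m : m <= l.+1 -> c (s m) = c (s 0).
    by case: m => // m ml; have /and3P[/eqP ->] := lt_s 0 m.+1 isT ml.
  by move=> /col0 -> /col0 ->.
have sub1 i j : i <= j -> j <= l.+1 -> trace p.1 (s i) \subset trace p.1 (s j).
  rewrite leq_eqVlt => /predU1P[-> //|ij jl].
  by have /and3P[_ /proper_sub] := lt_s i j ij jl.
have sub2 i j : i <= j -> j <= l.+1 -> trace p.2 (s j) \subset trace p.2 (s i).
  rewrite leq_eqVlt => /predU1P[-> //|ij jl].
  by have /and3P[_ _ /proper_sub] := lt_s i j ij jl.
(* The triangle will be [y], [x], [s l]; positivity of [l] gives [s l] a predecessor. *)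
have lt_pred : l.-1 < l by rewrite ltn_predL.
have /and3P[_ /properP[_ [x xl xNl]] _] := lt_s l.-1 l lt_pred (leqnSn l).
have /and3P[_ _ /properP[_ [y yl yNl]]] := lt_s l l.+1 (ltnSn l) (leqnn _).
move: xl xNl yl yNl; rewrite !inE => /andP[xl /eqP cx].
rewrite cx eqxx andbT => xNl /andP[yl /eqP cy]; rewrite cy eqxx andbT => yNl.
have xs i : i <= l.-1 -> ~~ adj (s i) x.
  move=> il; apply: contra xNl => xi.
  have /subsetP/(_ x) := sub1 i l.-1 il (leq_trans (leq_pred l) (leqnSn l)).
  by rewrite !inE xi cx eqxx => /(_ isT)/andP[].
have ys i : i <= l -> adj (s i) y.
  move=> il; have /subsetP/(_ y) := sub2 i l il (leqnSn l).
  by rewrite !inE yl cy eqxx => /(_ isT)/andP[].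
have x_last : adj (s l.+1) x.
  have /subsetP/(_ x) := sub1 l l.+1 (leqnSn l) (leqnn _).
  by rewrite !inE xl cx eqxx => /(_ isT)/andP[].
have nadj_s i j : i <= l.+1 -> j <= l.+1 -> ~~ adj (s i) (s j).
  by move=> il jl; apply: same_color_nadj; apply: col_s.
(* Apply 2P2-freeness to the edges from [s 0] to [y] and from [s l.+1] to [x]. *)
have yx : adj y x.
  by apply: (twoP2_free_adj G2P2 (ys 0 _) x_last); rewrite ?xs ?nadj_s.
have leaf_le (i : 'I_l) : i <= l.-1 by rewrite -ltnS prednK.
have leaf_lt (i : 'I_l) : i <= l.+1 by rewrite ltnW // ltnS ltnW.
apply: (@squid3_embedding G l y x (s l) (fun i : 'I_l => s i)) => // [i j||||||].
- have [ij|ij|ij] := ltngtP i j; last by move=> _; apply: val_inj.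
  + by move=> sij; have := lt_s i j ij (leaf_lt j); rewrite sij opposed_irrefl.
  + by move=> sij; have := lt_s j i ij (leaf_lt i); rewrite sij opposed_irrefl.
- by rewrite adj_sym ys.
- by rewrite adj_sym.
- by move=> i; rewrite adj_sym ys // ltnW.
- by move=> i; rewrite adj_sym xs.
- by move=> i; rewrite nadj_s.
- by move=> i j; rewrite nadj_s.
Qed.

(** Lengths count steps and are cut off below [l], so the values lie in a finite type independent of
    [G]. *)
Definition chain_lengths l (p : 'I_k * 'I_k) (a : G) : {set 'I_l} :=
  [set m : 'I_l | [exists t : m.-tuple G, path (opposed p) a t]].

(** If the sets agreed, prefixing [b] to a chain from [b] would give a longer one from [a], hence
    one of that length from [b]; iterating reaches length [l]. *)
Lemma chain_lengths_neq l p a b :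
    (forall a t, size t = l -> ~~ path (opposed p) a t) ->
  opposed p a b -> chain_lengths l p a != chain_lengths l p b.
Proof.
move=> no_chain ab; apply/eqP => eq_ab.
have chain m : m <= l -> exists2 t, size t = m & path (opposed p) b t.
  elim: m => [|m IHm] ml; first by exists [::].
  have [t /eqP sz_t bt] := IHm (ltnW ml).
  (* Length [l] is not recorded, but there [b :: t] is already a forbidden chain from [a]. *)
  case: (ltnP m.+1 l) => [lt_ml | ge_ml]; last first.
    have lE : l = m.+1 by apply/eqP; rewrite eqn_leq ml ge_ml.
    have := no_chain a (b :: t); rewrite /= ab bt lE (eqP sz_t).
    by move=> /(_ erefl).
  have : Ordinal lt_ml \in chain_lengths l p a.
    rewrite inE; apply/existsP.
    have sz_bt : size (b :: t) == m.+1 by rewrite /= eqSS.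
    by exists (Tuple sz_bt); rewrite /= ab.
  rewrite eq_ab inE => /existsP[u bu]; exists u => //.
  by rewrite size_tuple.
have [t sz_t bt] := chain l (leqnn l).
by have := no_chain b t sz_t; rewrite bt.
Qed.

End Traces.

(** * Bounding the order of a critical graph *)

Lemma critical_card_bound (G : sgraph) k l :
    0 < l -> vertex_critical k G -> free twoP2 G -> free (squid3 l) G ->
  #|G| <= #|{: 'I_k * {ffun 'I_k * 'I_k -> {set 'I_l.+1}}}|.
Proof.
move=> l_gt0 crit G2P2 Gsquid.
have /existsP[c /proper_coloringP c_ok] : colorable G k.
  by case: (crit) => <- _; apply: chi_colorable.
(* This code is injective; the cutoff [l.+1] is the number of steps that forces a squid. *)
apply: (leq_card (fun a => (c a, [ffun p => chain_lengths c l.+1 p a]))).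
move=> a b [cab /ffunP eq_ab]; apply/eqP; apply: contraT => a_neq_b.
have [p opp_ab] := critical_opposed c_ok G2P2 crit cab a_neq_b.
have := eq_ab p; rewrite !ffunE => /eqP; apply: contraTT => _.
apply: chain_lengths_neq opp_ab => d t sz_t.
by apply/negP => /(opposed_chain_squid c_ok G2P2 l_gt0 sz_t).
Qed.

(** * Finiteness from a bound on the order *)

Section OrdinalGraph.

Variables (n : nat) (A : {set 'I_n * 'I_n}).

(** Symmetrising and dropping loops makes every set [A] of pairs a graph, so finitely many codes
    cover all graphs on ['I_n]. *)
Definition ord_adj : rel 'I_n :=
  fun x y => (x != y) && (((x, y) \in A) || ((y, x) \in A)).

Lemma ord_adj_sym : symmetric ord_adj.
Proof. by move=> x y; rewrite /ord_adj eq_sym orbC. Qed.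

Lemma ord_adj_irrefl : irreflexive ord_adj.
Proof. by move=> x; rewrite /ord_adj eqxx. Qed.

Definition ord_graph : sgraph := SGraph ord_adj_sym ord_adj_irrefl.

End OrdinalGraph.

Lemma isomorphic_ord_graph (G : sgraph) :
  exists A : {set 'I_#|G| * 'I_#|G|}, isomorphic G (ord_graph A).
Proof.
exists [set p | adj (enum_val p.1) (enum_val p.2)].
exists enum_rank; first exact: enum_rank_bij.
move=> x y /=; rewrite /ord_adj !inE /= !enum_rankK (adj_sym y) orbb.
by apply: andb_idl => /adj_neq; rewrite (inj_eq enum_rank_inj).
Qed.

Lemma finitely_many_bounded (P : sgraph -> Prop) N :
  (forall G, P G -> #|G| <= N) -> finitely_many P.
Proof.
move=> P_le; pose T := {n : 'I_N.+1 & {set 'I_n * 'I_n}}.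
exists #|{: T}|, (fun i => ord_graph (tagged (enum_val i : T))) => G /P_le G_le.
have [A isoA] := isomorphic_ord_graph G.
have lt_G : #|G| < N.+1 by [].
exists (enum_rank (existT _ (Ordinal lt_G) A : T)).
by rewrite enum_rankK.
Qed.

Theorem theorem5p2 (k l : nat) (hk : 1 <= k) (hl : 1 <= l) :
  finitely_many (fun G : sgraph =>
    vertex_critical k G /\ free twoP2 G /\ free (squid3 l) G).
Proof.
apply: finitely_many_bounded => G [crit [G2P2 Gsquid]].
exact: critical_card_bound hl crit G2P2 Gsquid.
Qed.
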